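(* Let $\widehat G=(G,\sigma)$ be a signed graph and let $m\ge 3$. A closed walk of length $m$ in $G$ lifts to a simple $m$-cycle in $\mathrm{DC}(\widehat G)$ if and only if it is lift-simple. Thus $\mathrm{DC}(\widehat G)$ is $C_m$-free if and only if $\widehat G$ has no lift-simple closed walk of length $m$.
   Context: All graphs are finite and simple. A signed graph is a pair $\widehat G=(G,\sigma)$ with $\sigma:E(G)\to\{+1,-1\}$. The sign of a walk is the product of its edge signs, counted with multiplicity; a closed walk is balanced if its sign is $+1$, and a walk is negative if its sign is $-1$. The double cover $\mathrm{DC}(\widehat G)$ is the ordinary graph on $\{v^+:v\in V(G)\}\sqcup\{v^-:v\in V(G)\}$ in which each positive edge $uv$ of $\widehat G$ gives the edges $u^+v^+$ and $u^-v^-$, and each negative edge $uv$ gives the edges $u^+v^-$ and $u^-v^+$. A lift of a walk in $G$ is a walk in $\mathrm{DC}(\widehat G)$ which projects to it under $v^\pm\mapsto v$; a closed walk of length $m$ lifts to a simple $m$-cycle if it has a lift that is closed and traverses a simple cycle of length $m$ once. Let $W=v_0e_1v_1\cdots e_mv_m$ be a closed walk with $v_m=v_0$ and $m\ge3$, and let $W[i,j]$ be its subwalk from $v_i$ to $v_j$. $W$ is lift-simple if it is balanced and every subwalk $W[i,j]$ with $0\le i<j<m$ and $v_i=v_j$ is negative. A graph is $C_m$-free if it contains no cycle of length $m$ as a subgraph. *)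

(* Defs.v *)
From HB Require Import structures.
From mathcomp Require Import all_boot all_order all_algebra.

Set Implicit Arguments.
Unset Strict Implicit.
Unset Printing Implicit Defensive.

Import Order.TTheory GRing.Theory Num.Theory.
Local Open Scope ring_scope.

Record sgraph := SGraph {
  vertex :> finType;
  adj : rel vertex;
  adj_sym : symmetric adj;
  adj_irrefl : irreflexive adj }.

Definition edges (G : sgraph) : {set {set G}} :=
  [set [set e.1; e.2] | e : G * G & adj e.1 e.2].

(* The sign is a total function on sets of vertices; only its values on the
   edges are constrained, and only those values are used below. *)
Record signed_graph := SignedGraph {
  underlying :> sgraph;
  sgn : {set underlying} -> int;
  sgn_pm1 : forall e, e \in edges underlying -> sgn e = 1 \/ sgn e = -1 }.

(* In a simple graph a walk v_0 e_1 v_1 ... e_m v_m is determined by its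
   vertices. It is given by x = v_0 and p = [:: v_1; ...; v_m], so that its
   length is size p and v_i is nth x (x :: p) i. *)
Definition walk (G : sgraph) (x : G) (p : seq G) : Prop := path (@adj G) x p.

Definition closed_walk (G : sgraph) (m : nat) (x : G) (p : seq G) : Prop :=
  [/\ walk x p, size p = m & last x p = x].

Definition walk_sign (G : signed_graph) (x : G) (p : seq G) : int :=
  \prod_(s <- pairmap (fun u v => sgn [set u; v]) x p) s.

Definition balanced (G : signed_graph) (x : G) (p : seq G) : Prop :=
  walk_sign x p = 1.

Definition negative (G : signed_graph) (x : G) (p : seq G) : Prop :=
  walk_sign x p = -1.

(* W[i,j] starts at v_i and continues with v_(i+1), ..., v_j. *)
Definition subwalk_start (G : sgraph) (x : G) (p : seq G) (i : nat) : G :=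
  nth x (x :: p) i.

Definition subwalk_tail (G : sgraph) (p : seq G) (i j : nat) : seq G :=
  take (j - i) (drop i p).

Definition lift_simple (G : signed_graph) (x : G) (p : seq G) : Prop :=
  balanced x p /\
  forall i j : nat, (i < j < size p)%N ->
    nth x (x :: p) i = nth x (x :: p) j ->
    negative (subwalk_start x p i) (subwalk_tail p i j).

(* (v, true) is v^+ and (v, false) is v^-. *)
Definition dc_adj (G : signed_graph) : rel (G * bool) := fun a b =>
  adj a.1 b.1 &&
  (if sgn [set a.1; b.1] == 1 then a.2 == b.2 else a.2 != b.2).

Lemma dc_adj_sym (G : signed_graph) : symmetric (@dc_adj G).
Proof.
by move=> a b; rewrite /dc_adj adj_sym setUC [a.2 == _]eq_sym.
Qed.

Lemma dc_adj_irrefl (G : signed_graph) : irreflexive (@dc_adj G).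
Proof. by move=> a; rewrite /dc_adj adj_irrefl. Qed.

Definition DC (G : signed_graph) : sgraph :=
  SGraph (@dc_adj_sym G) (@dc_adj_irrefl G).

Definition dc_proj (G : signed_graph) (a : DC G) : G := a.1.

Definition is_lift (G : signed_graph) (x : G) (p : seq G)
    (y : DC G) (q : seq (DC G)) : Prop :=
  walk y q /\ map (@dc_proj G) (y :: q) = x :: p.

(* The bound on m is needed: ucycle alone accepts a single edge as a cycle of
   length 2. *)
Definition simple_cycle (H : sgraph) (m : nat) (c : seq H) : Prop :=
  [/\ (3 <= m)%N, size c = m & ucycle (@adj H) c].

(* belast y q lists v_0, ..., v_(m-1) when y :: q lists v_0, ..., v_m. *)
Definition lifts_to_simple_cycle (G : signed_graph) (m : nat)
    (x : G) (p : seq G) : Prop :=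
  exists (y : DC G) (q : seq (DC G)),
    [/\ is_lift x p y q, last y q = y & simple_cycle m (belast y q)].

Definition cycle_free (H : sgraph) (m : nat) : Prop :=
  ~ exists c : seq H, simple_cycle m c.

(* Main.v *)
(** A lift of a walk is determined by its first vertex, and the level [±] flips
    exactly along the negative edges. Hence along any subwalk of a lift the end
    levels agree iff the projected subwalk is positive. So the lift closes up
    iff the walk is balanced, and it repeats a vertex at steps [i < j] iff the
    walk does and [W[i,j]] is positive. *)
Require Import Defs.
From mathcomp Require Import all_boot all_order all_algebra.

Set Implicit Arguments.
Unset Strict Implicit.
Unset Printing Implicit Defensive.

Import GRing.Theory.
Local Open Scope ring_scope.

Lemma last_take_nth (T : Type) (x0 x : T) (s : seq T) (n : nat) :
  (n <= size s)%N -> last x (take n s) = nth x0 (x :: s) n.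
Proof. by elim: s x n => [|y s IHs] x [|n] //= ns; rewrite IHs. Qed.

Lemma nth_belast (T : Type) (x0 x : T) (s : seq T) (n : nat) :
  (n < size s)%N -> nth x0 (belast x s) n = nth x0 (x :: s) n.
Proof. by move=> ns; rewrite lastI nth_rcons size_belast ns. Qed.

(** For [q = rcons q' y], [belast y q] is [y :: q'], and [cycle] on that list means [path] from [y]
    along [rcons q' y]. *)
Lemma cycle_belast (T : Type) (e : rel T) (y : T) (q : seq T) :
  last y q = y -> path e y q -> cycle e (belast y q).
Proof.
by case/lastP: q => // q z; rewrite last_rcons => ->; rewrite belast_rcons.
Qed.

(** The exponent is the level flip that [dc_adj] prescribes on the edge, so products of signs become
    xors of flips. *)
Lemma sgn_adj (G : signed_graph) (u v : G) :
  adj u v -> sgn [set u; v] = (-1) ^+ (sgn [set u; v] != 1).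
Proof.
move=> uv; have : [set u; v] \in edges G.
  by apply/imsetP; exists (u, v); rewrite ?inE.
by case/sgn_pm1 => ->.
Qed.

Section Lifts.

Variable G : signed_graph.
Implicit Types (y : DC G) (q : seq (DC G)).

Lemma walk_proj y q : walk y q -> walk (dc_proj y) (map (@dc_proj G) q).
Proof.
rewrite /walk; elim: q y => //= z q IHq y /andP[/andP[yz _] /IHq ->].
by rewrite yz.
Qed.

(** By induction on [q]: the level differences of consecutive vertices telescope under xor. *)
Lemma walk_sign_proj y q : walk y q ->
  walk_sign (dc_proj y) (map (@dc_proj G) q) = (-1) ^+ (y.2 (+) (last y q).2).
Proof.
rewrite /walk /walk_sign; elim: q y => [|z q IHq] y /=.
  by rewrite big_nil addbb.
case/andP=> /andP[yz lvl] /IHq ind; rewrite big_cons {}ind sgn_adj //.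
rewrite -signr_addb; congr (_ ^+ nat_of_bool _).
move: lvl; rewrite /dc_proj; case: (sgn _ == 1) => /=.
- by move/eqP=> ->.
- by case: y.2 z.2 (last z q).2 => [] [] [].
Qed.

Lemma walk_sign_subwalk y q (i j : nat) :
    walk y q -> (i <= j <= size q)%N ->
  let p := map (@dc_proj G) q in
  walk_sign (subwalk_start (dc_proj y) p i) (subwalk_tail p i j) =
  (-1) ^+ ((nth y (y :: q) i).2 (+) (nth y (y :: q) j).2).
Proof.
move=> yq /andP[ij jq] /=; have iq := leq_trans ij jq.
rewrite /subwalk_start /subwalk_tail -map_drop -map_take.
rewrite -(map_cons (@dc_proj G)) (nth_map y) ?ltnS //.
have li := last_take_nth y y iq.
have := yq; rewrite /walk -{1}(cat_take_drop i q) cat_path li => /andP[_ path_i].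
rewrite walk_sign_proj; last exact: take_path.
congr (_ ^+ nat_of_bool (_ (+) snd _)).
(* The segment starts where [take i q] ends; glued together they form [take j q], whose last vertex
   is the one at index [j]. *)
by rewrite -li -last_cat -takeD subnKC // (last_take_nth y).
Qed.

Lemma lift_simple_proj y q :
    walk y q -> last (dc_proj y) (map (@dc_proj G) q) = dc_proj y ->
  lift_simple (dc_proj y) (map (@dc_proj G) q) <->
  last y q = y /\ uniq (belast y q).
Proof.
move=> yq; rewrite last_map => closed_p.
have eqDC (a b : DC G) : dc_proj a = dc_proj b -> a.2 = b.2 -> a = b.
  by case: a b => [a s] [b t]; rewrite /dc_proj /= => -> ->.
have nth_proj k : (k <= size q)%N ->
    nth (dc_proj y) (dc_proj y :: map (@dc_proj G) q) k
    = dc_proj (nth y (y :: q) k).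
  by move=> kq; rewrite -(map_cons (@dc_proj G)) (nth_map y).
rewrite /lift_simple /balanced /negative walk_sign_proj // size_map.
split=> [[bal neg]|[closed_q uniq_q]].
  split.
    by apply: eqDC => //; case: y.2 (last y q).2 bal => [] [].
  (* A repetition in [belast y q] has [i < j < size q], exactly the range in [lift_simple]; equal
     levels there make the sign [1] instead of [-1]. *)
  apply/negPn/negP => /(uniqPn y)[i [j [ij]]]; rewrite size_belast => jq.
  have iq := ltn_trans ij jq; rewrite !nth_belast // => eq_ij.
  have := neg i j; rewrite ij jq !nth_proj ?(ltnW iq) ?(ltnW jq) // eq_ij.
  move=> /(_ isT erefl); rewrite walk_sign_subwalk ?(ltnW ij) ?(ltnW jq) //.
  by rewrite eq_ij addbb.
split=> [|i j /andP[ij jq]]; first by rewrite closed_q addbb.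
have iq := ltn_trans ij jq.
rewrite !nth_proj ?(ltnW iq) ?(ltnW jq) // => eq_ij.
rewrite walk_sign_subwalk ?(ltnW ij) ?(ltnW jq) //.
(* Different levels give sign [-1]; equal levels over the same vertex would repeat a vertex of the
   lift. *)
have [lvl|] := eqVneq (nth y (y :: q) i).2 (nth y (y :: q) j).2; last first.
  by case: (_.2) (_.2) => [] [].
have /eqP := eqDC _ _ eq_ij lvl.
rewrite -!nth_belast // nth_uniq ?size_belast // => /eqP eij.
by rewrite eij ltnn in ij.
Qed.

Lemma exists_lift (x : G) (p : seq G) (y : DC G) :
  walk x p -> dc_proj y = x -> exists q, is_lift x p y q.
Proof.
rewrite /is_lift /walk; elim: p x y => [|z p IHp] x y /=.
  by move=> _ <-; exists [::].
case/andP=> xz zp yx.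
(* The unique neighbour of [y] over [z]: the level flips exactly when the edge is negative. *)
pose w : DC G := (z, (sgn [set x; z] != 1) (+) y.2).
have [//|q [wq [proj_q]]] := IHp z w zp; exists (w :: q); split.
  rewrite /= wq andbT /dc_adj; move: yx; rewrite /dc_proj => -> /=.
  by rewrite xz; case: (_ == 1) => //=; case: y.2.
by rewrite /= yx proj_q.
Qed.

Lemma lifts_to_simple_cycleP (m : nat) (x : G) (p : seq G) :
    (3 <= m)%N -> closed_walk m x p ->
  lifts_to_simple_cycle m x p <-> lift_simple x p.
Proof.
move=> m3 [xp size_p last_p]; split.
  case=> y [q [[yq [eqx eqp]] last_q [_ _ /andP[_ uniq_q]]]]; subst x p.
  exact/lift_simple_proj.
(* The lift may start at either level; here it starts at the positive one. *)
have [q [yq [eqp]]] := @exists_lift x p (x, true) xp erefl.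
subst p; rewrite size_map in size_p.
case/(@lift_simple_proj (x, true) q yq last_p) => last_q uniq_q.
exists (x, true), q; split=> //; split; rewrite ?size_belast //.
by rewrite /ucycle cycle_belast.
Qed.

(** A cycle of the double cover, closed up by repeating its first vertex, is a lift of its own
    projection. This turns cycles into closed walks of the base graph. *)
Lemma simple_cycle_closed_walk (m : nat) (c : seq (DC G)) :
    simple_cycle m c ->
  exists (x : G) (p : seq G), closed_walk m x p /\ lifts_to_simple_cycle m x p.
Proof.
case: c => [|y c] [m3 size_c cyc_c]; first by rewrite -size_c in m3.
have yq : walk y (rcons c y) by case/andP: cyc_c.
exists (dc_proj y), (map (@dc_proj G) (rcons c y)); split.
  split; first exact: walk_proj.
  - by rewrite size_map size_rcons.
  - by rewrite last_map last_rcons.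
exists y, (rcons c y); split; rewrite ?last_rcons ?belast_rcons //.
Qed.

End Lifts.

Theorem theorem2p7 (G : signed_graph) (m : nat) (hm : (3 <= m)%N) :
  (forall (x : G) (p : seq G), closed_walk m x p ->
     (lifts_to_simple_cycle m x p <-> lift_simple x p)) /\
  (cycle_free (DC G) m <->
     ~ exists (x : G) (p : seq G), closed_walk m x p /\ lift_simple x p).
Proof.
split=> [x p|]; first exact: lifts_to_simple_cycleP.
split=> [no_cycle [x [p [xp]]]|no_walk [c]].
  case/(lifts_to_simple_cycleP hm xp) => y [q [_ _ cyc]].
  by apply: no_cycle; exists (belast y q).
case/simple_cycle_closed_walk => x [p [xp lifts]].
apply: no_walk; exists x, p; split=> //.
exact/(lifts_to_simple_cycleP hm xp).
Qed.
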